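(* Let $n,k,r,z$ be integers with $n,k\ge 1$, $r,z\ge 0$ and $z<n-r$, and let $\mathcal{Q}$ be a finite alphabet with $|\mathcal{Q}|=Q\ge 2$. For any $(n,k,r,z)_{\mathcal{Q}}$ secret sharing scheme with preprocessing functions $\{E_{I,i}\}_{i\in I,\ I\subset[n],\ |I|\ge n-r}$ and decoding functions $\{D_I\}_{I\subset[n],\ |I|\ge n-r}$, and for every $I\subset[n]$ with $|I|\ge n-r$, the communication overhead satisfies $$\mathrm{CO}(I)\ \ge\ \frac{kz}{|I|-z}.$$
   Context: $[n]=\{1,\dots,n\}$; for $\bm{c}=(c_1,\dots,c_n)$ and $I\subset[n]$, $\bm{c}_I=(c_i)_{i\in I}$. $H$ denotes Shannon entropy. All logarithms (including those in entropies) are to base $Q$, where $Q=|\mathcal{Q}|$. An $(n,k,r,z)_{\mathcal{Q}}$ secret sharing scheme consists of a randomized encoding function $F$ mapping a secret $\bm{m}\in\mathcal{Q}^k$ to $\bm{c}=(c_1,\dots,c_n)=F(\bm{m})\in\mathcal{Q}^n$ (the internal randomness of $F$ is independent of $\bm{m}$, and $\bm{m}$ is uniformly distributed on $\mathcal{Q}^k$) such that: (1) (Reliability) $H(\bm{m}\mid\bm{c}_I)=0$ for all $I\subset[n]$ with $|I|=n-r$, i.e. $\bm m$ is a function of $\bm c_I$; (2) (Secrecy) $H(\bm{m}\mid\bm{c}_I)=H(\bm{m})$ for all $I\subset[n]$ with $|I|=z$. Preprocessing and decoding functions: for each $I\subset[n]$ with $|I|\ge n-r$ and each $i\in I$, $E_{I,i}:\mathcal{Q}\to\mathcal{S}_{I,i}$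 is a function into a finite set with $|\mathcal{S}_{I,i}|\le|\mathcal{Q}|$; put $e_{I,i}=E_{I,i}(c_i)$ and $\bm{e}_I=(e_{I,i})_{i\in I}$. $D_I:\prod_{i\in I}\mathcal{S}_{I,i}\to\mathcal{Q}^k$ is a function with $D_I(\bm{e}_I)=\bm{m}$ (always). The communication overhead is $\mathrm{CO}(I)=\sum_{i\in I}\log|\mathcal{S}_{I,i}|-k$. *)

(* Defs.v *)
From HB Require Import structures.
From mathcomp Require Import all_boot all_order all_algebra.
From mathcomp Require Import all_classical all_reals all_analysis.
Set Implicit Arguments.
Unset Strict Implicit.
Unset Printing Implicit Defensive.
Import Order.TTheory GRing.Theory Num.Theory.
Local Open Scope classical_set_scope.
Local Open Scope ring_scope.

Definition logb (R : realType) (b : nat) (x : R) : R := ln x / ln b%:R.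

Section finite_valued_random_variables.
Context {R : realType} {d : measure_display} {Omega : measurableType d}.
Variable P : probability Omega R.

Definition finite_rv (T : finType) (X : Omega -> T) : Prop :=
  forall x : T, measurable (X @^-1` [set x]).

Definition pr (T : finType) (X : Omega -> T) (x : T) : R :=
  fine (P (X @^-1` [set x])).

(* As [ln 0 = 0] and [x / 0 = 0], outcomes of probability zero contribute 0 to
   the sums below. *)
Definition entropy (b : nat) (T : finType) (X : Omega -> T) : R :=
  - \sum_(x : T) pr X x * logb b (pr X x).

Definition cond_entropy (b : nat) (T T' : finType)
    (X : Omega -> T) (Y : Omega -> T') : R :=
  let XY := fun o => (X o, Y o) in
  - \sum_(y : T') \sum_(x : T)
      pr XY (x, y) * logb b (pr XY (x, y) / pr Y y).

Definition uniform_rv (T : finType) (X : Omega -> T) : Prop :=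
  forall x : T, pr X x = #|T|%:R^-1.

Definition independent_rv (T : finType) (d' : measure_display)
    (U : measurableType d') (X : Omega -> T) (W : Omega -> U) : Prop :=
  forall (A : set T) (B : set U), measurable B ->
    (P (X @^-1` A `&` W @^-1` B) = P (X @^-1` A) * P (W @^-1` B))%E.

End finite_valued_random_variables.

Definition index_in (n : nat) (I : {set 'I_n}) : finType := {i : 'I_n | i \in I}.

Definition subvec (n : nat) (Q : finType) (I : {set 'I_n})
    (c : {ffun 'I_n -> Q}) : {ffun index_in I -> Q} :=
  [ffun i => c (val i)].

Definition codeword (Omega U : Type) (n k : nat) (Q : finType)
    (F : {ffun 'I_k -> Q} -> U -> {ffun 'I_n -> Q})
    (m : Omega -> {ffun 'I_k -> Q}) (w : Omega -> U) :
    Omega -> {ffun 'I_n -> Q} :=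
  fun o => F (m o) (w o).

(* The randomized encoding is a map [F] of the secret [m] and of the internal
   randomness [w], the latter being an arbitrary random element. *)
Record secret_sharing_scheme (R : realType) (d : measure_display)
    (Omega : measurableType d) (P : probability Omega R)
    (d' : measure_display) (U : measurableType d')
    (n k r z : nat) (Q : finType)
    (F : {ffun 'I_k -> Q} -> U -> {ffun 'I_n -> Q})
    (m : Omega -> {ffun 'I_k -> Q}) (w : Omega -> U) : Prop :=
  SecretSharingScheme {
    sss_measurable_enc : forall s c, measurable (F s @^-1` [set c]) ;
    sss_measurable_secret : finite_rv m ;
    sss_measurable_randomness : measurable_fun setT w ;
    sss_uniform : uniform_rv P m ;
    sss_independent : independent_rv P m w ;
    sss_reliability : forall I : {set 'I_n}, #|I| = (n - r)%N ->
      cond_entropy P #|Q| m (fun o => subvec I (codeword F m w o)) = 0 ;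
    sss_secrecy : forall I : {set 'I_n}, #|I| = z ->
      cond_entropy P #|Q| m (fun o => subvec I (codeword F m w o))
        = entropy P #|Q| m
  }.

Definition large_set (n r : nat) : Type := {I : {set 'I_n} | (n - r <= #|I|)%N}.

Definition share_alphabets (n r : nat) : Type :=
  forall I : large_set n r, index_in (sval I) -> finType.

Definition preprocessing (n r : nat) (Q : finType)
    (S : share_alphabets n r) : Type :=
  forall (I : large_set n r) (i : index_in (sval I)), Q -> S I i.

Definition decoding (n k r : nat) (Q : finType)
    (S : share_alphabets n r) : Type :=
  forall I : large_set n r,
    {dffun forall i : index_in (sval I), S I i} -> {ffun 'I_k -> Q}.

Definition preprocess (n r : nat) (Q : finType) (S : share_alphabets n r)
    (E : preprocessing Q S) (I : large_set n r) (c : {ffun 'I_n -> Q}) :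
    {dffun forall i : index_in (sval I), S I i} :=
  [ffun i : index_in (sval I) => E I i (c (val i))].

Definition CO (R : realType) (n k r : nat) (Q : finType)
    (S : share_alphabets n r) (I : large_set n r) : R :=
  (\sum_(i : index_in (sval I)) logb #|Q| #|S I i|%:R) - k%:R.

(* Main.v *)
Require Import Defs.
From HB Require Import structures.
From mathcomp Require Import all_boot all_order all_algebra.
From mathcomp Require Import all_classical all_reals all_analysis.
From mathcomp Require Import ring lra.

(** Fix a set [Z] of [z] indices of [I].  By secrecy [H(m | c_Z) = k], whereas,
    once [c_Z] and hence [e_Z] is known, the secret is determined by the
    remaining symbols of [e_I], so that [H(m | c_Z)] is at most the sum of
    [log |S_{I,i}|] over [I \ Z].  Taking for [Z] the [z] largest alphabets, the
    sum over [Z] is at least [z / (|I| - z)] times the sum over [I \ Z], hence at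
    least [kz / (|I| - z)]. *)

Import Order.TTheory GRing.Theory Num.Theory.
Local Open Scope classical_set_scope.
Local Open Scope ring_scope.

Section logarithms.
Context {R : realType}.

Lemma logb_prod (b : nat) (T : finType) (B : pred T) (f : T -> nat) :
  (forall i, 0 < f i)%N ->
  logb b (\prod_(i | B i) f i)%N%:R = \sum_(i | B i) logb b (f i)%:R :> R.
Proof.
move=> f0; rewrite /logb -mulr_suml; congr (_ / _).
(* Positivity of the partial products is carried through the induction because [lnM] requires it. *)
suff [] : (0 < \prod_(i | B i) f i)%N /\
  ln (\prod_(i | B i) f i)%N%:R = \sum_(i | B i) ln (f i)%:R :> R by [].
elim/big_rec2: _ => [|i p x _ [x0 eqx]]; first by rewrite ln1.
by rewrite muln_gt0 f0 x0 natrM lnM ?posrE ?ltr0n// eqx.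
Qed.

(** This is [ln (1 + x) <= x] at [x = t^-1 - 1]. *)
Lemma ln_ge_1BV (t : R) : 0 < t -> 1 - t^-1 <= ln t.
Proof.
move=> t0; have := @le_ln1Dx R (t^-1 - 1).
rewrite [1 + _]addrC subrK lnV ?posrE//.
by have : 0 < t^-1; [rewrite invr_gt0 | lra].
Qed.

(** Gibbs' inequality against the uniform law on [B] points. It is meant for the joint probabilities
    of [(x, y)] at a fixed [y]; their sum, the probability of [y], may be 0, so [p] is left
    unnormalized. *)
Lemma unnormalized_entropy_le (T : finType) (p : T -> R) (B : nat) :
  (0 < B)%N -> (forall x, 0 <= p x) ->
  (#|[pred x | p x != 0%R]| <= B)%N ->
  - (\sum_x p x * ln (p x / \sum_x p x)) <= (\sum_x p x) * ln B%:R.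
Proof.
move=> B0 p0 suppB; set s := \sum_x p x.
have s0 : 0 <= s by exact: sumr_ge0.
have B0' : 0 < B%:R :> R by rewrite ltr0n.
(* [ln t >= 1 - 1/t] at [t = B p(x) / s] *)
have term x : p x != 0 -> p x - s / B%:R <= p x * (ln (p x / s) + ln B%:R).
  move=> px0; have px : 0 < p x by rewrite lt_neqAle eq_sym px0 p0.
  have sx : 0 < s.
    by apply: lt_le_trans px _; rewrite /s (bigD1 x)//= lerDl sumr_ge0.
  have t0 : 0 < p x / s * B%:R by rewrite !mulr_gt0// invr_gt0.
  rewrite -lnM ?posrE ?divr_gt0//.
  apply: (@le_trans _ _ (p x * (1 - (p x / s * B%:R)^-1))).
    by rewrite le_eqVlt; apply/orP; left; apply/eqP; field; rewrite px0 !gt_eqF.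
  by rewrite ler_pM2l// ln_ge_1BV.
have : \sum_(x | p x != 0) (p x - s / B%:R) <=
       \sum_(x | p x != 0) p x * (ln (p x / s) + ln B%:R).
  by apply: ler_sum => x; exact: term.
have suppE (g : T -> R) : \sum_(x | p x != 0) p x * g x = \sum_x p x * g x.
  rewrite [RHS](bigID (fun x => p x != 0))/= [X in _ = _ + X]big1 ?addr0// => x.
  by rewrite negbK => /eqP ->; rewrite mul0r.
rewrite suppE sumrB sumr_const.
have -> : \sum_(x | p x != 0) p x = s.
  by under eq_bigr do rewrite -[p _]mulr1; rewrite suppE;
    apply: eq_bigr => x _; rewrite mulr1.
have -> : \sum_x p x * (ln (p x / s) + ln B%:R) =
    (\sum_x p x * ln (p x / s)) + s * ln B%:R.
  by under eq_bigr do rewrite mulrDr; rewrite big_split/= -mulr_suml.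
(* At most [B] support points each subtract [s / B], so the lower bound obtained above is
   nonnegative. *)
have : s / B%:R *+ #|[pred x | p x != 0]| <= s.
  by rewrite -mulr_natr -mulrA ler_piMr// mulrC ler_pdivrMr// mul1r ler_nat.
by move=> h1 h2; lra.
Qed.

End logarithms.

Section finite_valued.
Context {R : realType} {d : measure_display} {Omega : measurableType d}.
Variable P : probability Omega R.

Lemma preimage_fin_bigcup (T : Type) (X : Omega -> T) (A : set T) :
  X @^-1` A = \bigcup_(x in A) X @^-1` [set x].
Proof.
by apply/seteqP; split=> [t XA|t [x Ax /= Xt]]; [exists (X t) | rewrite /= Xt].
Qed.

Lemma finite_rv_measurable (T : finType) (X : Omega -> T) (A : set T) :
  finite_rv X -> measurable (X @^-1` A).
Proof.
move=> mX; rewrite preimage_fin_bigcup.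
by apply: fin_bigcup_measurable => [|x _]; [exact: finite_finset | exact: mX].
Qed.

(** Finite additivity over the fibre of [f] above [y]. Total mass (constant [f]) and marginals ([f]
    a projection) are instances. *)
Lemma pr_comp (T T' : finType) (X : Omega -> T) (f : T -> T') (y : T') :
  finite_rv X -> pr P (f \o X) y = \sum_(x | f x == y) pr P X x.
Proof.
move=> mX; rewrite /pr sum_fine; last first.
  by move=> x _; exact: fin_num_measure.
congr fine; rewrite comp_preimage preimage_fin_bigcup measure_fin_bigcup//.
- have -> : f @^-1` [set y] = [set` enum [pred x | f x == y]].
    by apply/seteqP; split => x /=; rewrite mem_enum inE => /eqP.
  by rewrite -fsbig_seq ?enum_uniq// big_enum.
- exact: finite_finset.
- by move=> x x1 _ _ [t [/= <- <-]].
Qed.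

(** An outcome is needed to exhibit a symbol in each share alphabet. *)
Lemma probability_nonempty : [set: Omega] !=set0.
Proof.
apply/set0P/negP => /eqP OmegaE; have := probability_setT P.
by rewrite OmegaE measure0 => /eqP; rewrite eq_sym onee_eq0.
Qed.

Lemma pr_ge0 (T : finType) (X : Omega -> T) (x : T) : 0 <= pr P X x.
Proof. by rewrite fine_ge0. Qed.

Lemma sum_pr (T : finType) (X : Omega -> T) :
  finite_rv X -> \sum_x pr P X x = 1.
Proof.
move=> mX; have := pr_comp _ _ X (fun=> tt) tt mX.
rewrite (eq_bigl predT)// => <-; rewrite /pr.
have -> : ((fun=> tt) \o X) @^-1` [set tt] = setT by apply/seteqP; split.
by rewrite probability_setT.
Qed.

Lemma sum_pr_pair (T T' : finType) (X : Omega -> T) (Y : Omega -> T') (y : T') :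
  finite_rv (fun o => (X o, Y o)) ->
  \sum_x pr P (fun o => (X o, Y o)) (x, y) = pr P Y y.
Proof.
move=> mXY; rewrite (pr_comp _ _ (fun o => (X o, Y o)) snd y mXY).
rewrite (reindex (fun x => (x, y))) /=.
  by apply: eq_bigl => x; rewrite eqxx.
by exists fst => [x|[x y1]] //=; rewrite inE => /eqP/= ->.
Qed.

(** Each [y] contributes at most [pr P Y y * logb b B], since [X] has at most [B] values on [Y = y];
    these weights sum to 1. *)
Lemma cond_entropy_le (b : nat) (T T' : finType) (X : Omega -> T)
    (Y : Omega -> T') (B : nat) :
  (1 < b)%N -> (0 < B)%N -> finite_rv (fun o => (X o, Y o)) ->
  (forall y, exists2 A : {set T}, (#|A| <= B)%N &
     forall o, Y o = y -> X o \in A) ->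
  cond_entropy P b X Y <= logb b B%:R.
Proof.
move=> b1 B0 mXY fiberB; rewrite /cond_entropy -sumrN.
have mY : finite_rv Y.
  move=> y; have -> : Y = snd \o (fun o => (X o, Y o)) by [].
  by rewrite comp_preimage; exact: finite_rv_measurable.
have -> : logb b B%:R = \sum_y pr P Y y * logb b B%:R :> R.
  by rewrite -mulr_suml sum_pr ?mul1r.
apply: ler_sum => y _.
rewrite /logb; under eq_bigr do rewrite mulrA.
rewrite -mulr_suml -mulNr mulrA ler_pM2r ?invr_gt0 ?ln_gt0 ?ltr1n//.
rewrite -(sum_pr_pair _ _ X Y y mXY).
apply: unnormalized_entropy_le => // [x|]; first exact: pr_ge0.
have [A AB XA] := fiberB y; apply: leq_trans AB; apply/subset_leq_card.
apply/fintype.subsetP => x; rewrite inE; apply: contraNT => xA; rewrite /pr.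
rewrite (_ : _ @^-1` _ = set0) ?measure0//; apply/seteqP; split=> // o [Xx /XA].
by rewrite Xx (negbTE xA).
Qed.

Lemma entropy_uniform (b : nat) (T : finType) (X : Omega -> T) :
  (0 < #|T|)%N -> uniform_rv P X -> entropy P b X = logb b #|T|%:R.
Proof.
move=> T0 uX; rewrite /entropy; under eq_bigr do rewrite uX.
rewrite sumr_const -mulrnAl -mulr_natl divff ?pnatr_eq0 -?lt0n// mul1r.
by rewrite /logb lnV ?posrE ?ltr0n// mulNr opprK.
Qed.

End finite_valued.

(** Greedy choice: each step adds a maximizer of [f] outside the current set. *)
Lemma exists_top_set (R : realDomainType) (T : finType) (f : T -> R) (z : nat) :
  (z <= #|T|)%N ->
  exists2 A : {set T}, #|A| = z &
    forall i j, i \in A -> j \notin A -> f j <= f i.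
Proof.
elim: z => [_|z IH zT].
  by exists finset.set0 => [|i j]; rewrite ?cards0 ?inE.
have [A Az Atop] := IH (ltnW zT).
have : (0 < #|~: A|)%N by rewrite cardsCs finset.setCK Az subn_gt0.
case/card_gt0P => i0; rewrite inE => i0A.
case: (@arg_maxP _ _ _ i0 (fun i => i \notin A) f i0A) => a aA amax.
exists (a |: A)%SET => [|i j]; first by rewrite cardsU1 aA Az.
rewrite !inE negb_or => /orP[/eqP -> |iA] /andP[_ jA]; first exact: amax.
exact: Atop.
Qed.

(** Sum [f j <= f i] over all pairs with [i] in [A] and [j] outside [A]. *)
Lemma top_set_sum_ge (R : realDomainType) (T : finType) (f : T -> R)
    (A : {set T}) :
  (forall i j, i \in A -> j \notin A -> f j <= f i) ->
  #|A|%:R * \sum_(i | i \notin A) f i <= (#|T|%:R - #|A|%:R) * \sum_(i in A) f i.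
Proof.
move=> Atop; have -> : #|T|%:R - #|A|%:R = #|[pred i | i \notin A]|%:R :> R.
  rewrite -(cardC (mem A)) natrD addrAC subrr add0r.
  by congr _%:R; apply: eq_card.
rewrite !mulr_natl -!sumr_const exchange_big/=.
by do 2!apply: ler_sum => ? ?; exact: Atop.
Qed.

Section decoding.
Context {R : realType} {n k r z : nat} {Q : finType}.
Context {d : measure_display} {Omega : measurableType d}.
Context {P : probability Omega R}.
Context {d' : measure_display} {U : measurableType d'}.
Context {F : {ffun 'I_k -> Q} -> U -> {ffun 'I_n -> Q}}.
Context {m : Omega -> {ffun 'I_k -> Q}} {w : Omega -> U}.
Hypothesis hF : secret_sharing_scheme P r z F m w.

(** On the event [m = s] the codeword is [F s] of the randomness, so measurability of each [F s]
    suffices. *)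
Lemma finite_rv_secret_codeword :
  finite_rv (fun o => (m o, codeword F m w o)).
Proof.
case: hF => mF mm mw _ _ _ _ [s c].
rewrite (_ : _ @^-1` _ = m @^-1` [set s] `&` w @^-1` (F s @^-1` [set c])).
  apply: measurableI; first exact: mm.
  by rewrite -[X in measurable X]setTI; apply: mw => //; exact: mF.
by apply/seteqP; split=> [t [<- <-]|t [/= <- <-]].
Qed.

Context {S : share_alphabets n r}.
Variables (E : preprocessing Q S) (D : decoding k Q S) (I : large_set n r).
Hypothesis hD : forall o, D I (preprocess E I (codeword F m w o)) = m o.

Lemma share_alphabet_gt0 (i : index_in (sval I)) : (0 < #|S I i|)%N.
Proof.
case: (probability_nonempty P) => o _.
by apply/card_gt0P; exists (E I i (codeword F m w o (val i))).
Qed.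

Lemma secret_size_le (A : {set index_in (sval I)}) :
  (1 < #|Q|)%N -> #|A| = z ->
  k%:R <= \sum_(i | i \notin A) logb #|Q| #|S I i|%:R :> R.
Proof.
move=> Q1 Az; rewrite -logb_prod; last exact: share_alphabet_gt0.
(* [A] lives in the subtype of indices of [I], whereas secrecy concerns subsets of ['I_n]. *)
pose Z : {set 'I_n} := [set val i | i in A]%SET.
have Zz : #|Z| = z by rewrite card_imset//; exact: val_inj.
pose cZ := fun o => subvec Z (codeword F m w o).
have lnQ : ln #|Q|%:R != 0 :> R by rewrite gt_eqF// ln_gt0// ltr1n.
have Hm : entropy P #|Q| m = k%:R.
  have cardM : #|{ffun 'I_k -> Q}| = (#|Q| ^ k)%N by rewrite card_ffun card_ord.
  rewrite entropy_uniform ?cardM ?expn_gt0 ?(ltnW Q1)//; last exact: sss_uniform hF.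
  by rewrite natrX /logb lnXn ?ltr0n ?(ltnW Q1)// -[X in X / _]mulr_natl mulfK.
rewrite -Hm -(sss_secrecy hF Zz); apply: cond_entropy_le => //.
- by rewrite prodn_gt0// => i; exact: share_alphabet_gt0.
- move=> [s y].
  pose f (u : {ffun 'I_k -> Q} * {ffun 'I_n -> Q}) := (u.1, subvec Z u.2).
  exact: (finite_rv_measurable _ _ (f @^-1` [set (s, y)])
    finite_rv_secret_codeword).
(* A value [y] that is never attained has an empty fibre. *)
move=> y; have [[t0 yt0] | noo] := pselect (exists o, cZ o = y); last first.
  by exists finset.set0 => [|t yt]; [rewrite cards0 | case: noo; exists t].
(* Candidate inputs of [D I] given [y]: on [A] the symbol computed from the reference outcome [t0],
   elsewhere any symbol. Their decodings include every secret compatible with [y]. *)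
pose G (i : index_in (sval I)) : pred (S I i) :=
  if i \in A then pred1 (E I i (codeword F m w t0 (val i))) else predT.
exists (D I @: (family G : simpl_pred {dffun forall i, S I i}))%SET.
  apply: leq_trans (leq_imset_card _ _) _.
  rewrite card_family foldrE big_map big_enum/= [X in (_ <= X)%N]big_mkcond/=.
  apply: leq_prod => i _; rewrite /G; case: ifP => iA //=.
  by rewrite card1.
move=> o yo; apply/imsetP; exists (preprocess E I (codeword F m w o)) => //.
apply/familyP => i; rewrite /G ffunE; case: ifP => iA //.
(* On [A] the outcomes [o] and [t0] have equal shares, both being read off from [y]. *)
rewrite inE; apply/eqP; congr (E I i _).
have iZ : val i \in Z by exact: imset_f.
have := congr1 (fun g : {ffun index_in Z -> Q} => g (exist _ (val i) iZ))
  (etrans yo (esym yt0)).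
by rewrite !ffunE.
Qed.

End decoding.

Theorem theorem1 (R : realType)
    (n k r z : nat) (hn : (1 <= n)%N) (hk : (1 <= k)%N) (hz : (z < n - r)%N)
    (Q : finType) (hQ : (2 <= #|Q|)%N)
    (d : measure_display) (Omega : measurableType d) (P : probability Omega R)
    (d' : measure_display) (U : measurableType d')
    (F : {ffun 'I_k -> Q} -> U -> {ffun 'I_n -> Q})
    (m : Omega -> {ffun 'I_k -> Q}) (w : Omega -> U)
    (hF : secret_sharing_scheme P r z F m w)
    (S : share_alphabets n r) (E : preprocessing Q S) (D : decoding k Q S)
    (hS : forall (I : large_set n r) (i : index_in (sval I)),
        (#|S I i| <= #|Q|)%N)
    (hD : forall (I : large_set n r) (o : Omega),
        D I (preprocess E I (codeword F m w o)) = m o)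
    (I : large_set n r) :
  (k * z)%:R / (#|sval I|%:R - z%:R) <= CO R k Q S I.
Proof.
pose L (i : index_in (sval I)) : R := logb #|Q| #|S I i|%:R.
have cardI : #|index_in (sval I)| = #|sval I| by rewrite card_sig.
have zI : (z < #|sval I|)%N by exact: leq_trans hz (svalP I).
have [|A Az Atop] := @exists_top_set _ _ L z; first by rewrite cardI ltnW.
have kA := secret_size_le hF E D I (hD I) A hQ Az.
have := top_set_sum_ge _ _ L A Atop; rewrite Az cardI => topA.
have Iz : 0 < #|sval I|%:R - z%:R :> R by rewrite subr_gt0 ltr_nat.
(* By [kA] and [topA], [k * z] is at most [z] times the sum of [L] off [A], hence at most [#|I| - z]
   times the sum over [A]. *)
apply: (@le_trans _ _ (\sum_(i in A) L i)).
  rewrite ler_pdivrMr// natrM mulrC [leRHS]mulrC; apply: le_trans topA.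
  by rewrite ler_wpM2l.
(* The overhead is the sum over [A] plus the excess over [k] of the sum off [A], which is
   nonnegative by [kA]. *)
by rewrite /CO [X in _ <= X - _](bigID (mem A))/= -addrA lerDl subr_ge0.
Qed.
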